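(* Let $n \geq 2$ be an integer and $1 \leq p < \infty$. If $\ell^p_n$ has a computable presentation, then $p$ is a computable real number.
   Context: $\ell^p_n$ denotes $\mathbb{F}^n$ with the norm $\|(x_1,\dots,x_n)\|_p = (\sum_j |x_j|^p)^{1/p}$, where the scalar field $\mathbb{F}$ is $\mathbb{R}$ or $\mathbb{C}$; $\mathbb{F}_{\mathbb{Q}} = \mathbb{F} \cap \mathbb{Q}(i)$. A presentation of a Banach space $\mathcal{B}$ is a pair $(\mathcal{B}, (v_n)_{n\in\mathbb{N}})$ where $(v_n)$ is a sequence of vectors whose linear span is dense in $\mathcal{B}$; its rational vectors are the finite combinations $\sum_{j=0}^m \alpha_j v_j$ with $\alpha_j \in \mathbb{F}_{\mathbb{Q}}$. The presentation is computable if there is an algorithm that, given $k \in \mathbb{N}$ and a finite tuple of rational scalars $(\alpha_0,\dots,\alpha_m)$, outputs a rational $q$ with $|q - \|\sum_j \alpha_j v_j\|| < 2^{-k}$. A space is computably presentable if it has a computable presentation. *)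

(* Defs.v *)
From HB Require Import structures.
From mathcomp Require Import all_boot all_order all_algebra.
From mathcomp Require Import complex.
From mathcomp Require Import reals exp.

Set Implicit Arguments.
Unset Strict Implicit.
Unset Printing Implicit Defensive.

Import Order.TTheory GRing.Theory Num.Theory.
Local Open Scope ring_scope.

(* Total recursive functions of several natural-number arguments: the smallest
   class containing zero, successor and the projections, and closed under
   composition, primitive recursion and minimization of regular functions
   (those for which the minimization always succeeds).  By Kleene's normal form
   theorem these are exactly the total functions computed by an algorithm.  The
   closure rules are given by defining equations, so that the class is closed
   under extensional equality. *)
Inductive recursive : forall n : nat, (n.-tuple nat -> nat) -> Prop :=
| recursive_zero n (h : n.-tuple nat -> nat) :
    (forall v, h v = 0%N) -> recursive h
| recursive_succ (h : 1.-tuple nat -> nat) :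
    (forall v, h v = (tnth v ord0).+1) -> recursive h
| recursive_proj n (i : 'I_n) (h : n.-tuple nat -> nat) :
    (forall v, h v = tnth v i) -> recursive h
| recursive_comp m n (f : m.-tuple nat -> nat)
    (g : 'I_m -> n.-tuple nat -> nat) (h : n.-tuple nat -> nat) :
    recursive f -> (forall i, recursive (g i)) ->
    (forall v, h v = f [tuple g i v | i < m]) -> recursive h
| recursive_primrec n (f : n.-tuple nat -> nat)
    (g : n.+2.-tuple nat -> nat) (h : n.+1.-tuple nat -> nat) :
    recursive f -> recursive g ->
    (forall v : n.-tuple nat, h [tuple of 0%N :: v] = f v) ->
    (forall y (v : n.-tuple nat), h [tuple of y.+1 :: v] =
       g [tuple of y :: h [tuple of y :: v] :: v]) ->
    recursive h
| recursive_mu n (f : n.+1.-tuple nat -> nat) (h : n.-tuple nat -> nat) :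
    recursive f ->
    (forall v : n.-tuple nat, f [tuple of h v :: v] = 0%N) ->
    (forall (v : n.-tuple nat) y, (y < h v)%N -> f [tuple of y :: v] != 0%N) ->
    recursive h.

(* A numbering of a countable type A is a surjection nat -> A, c being a code of
   its image.  The numberings below are built from the effective bijection
   CodeSeq.decode between nat and seq nat. *)
Definition computable_wrt (A B : Type) (nuA : nat -> A) (nuB : nat -> B)
    (f : A -> B) : Prop :=
  exists g : 1.-tuple nat -> nat,
    recursive g /\ forall c : nat, nuB (g [tuple c]) = f (nuA c).

Definition nat_num (c : nat) : nat := c.

Definition pair_num (A B : Type) (nuA : nat -> A) (nuB : nat -> B) (c : nat) :
    A * B :=
  let s := CodeSeq.decode c in (nuA (nth 0%N s 0), nuB (nth 0%N s 1)).

Definition seq_num (A : Type) (nuA : nat -> A) (c : nat) : seq A :=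
  map nuA (CodeSeq.decode c).

(* [:: a; b; d] codes (a - b) / (d + 1). *)
Definition rat_num (c : nat) : rat :=
  let s := CodeSeq.decode c in
  ((nth 0%N s 0)%:R - (nth 0%N s 1)%:R) / (nth 0%N s 2).+1%:R.

Lemma pair_num_surj (A B : Type) (nuA : nat -> A) (nuB : nat -> B) :
  (forall a, exists c, nuA c = a) -> (forall b, exists c, nuB c = b) ->
  forall x, exists c, pair_num nuA nuB c = x.
Proof.
move=> sA sB [a b]; have [c <-] := sA a; have [d <-] := sB b.
by exists (CodeSeq.code [:: c; d]); rewrite /pair_num CodeSeq.codeK.
Qed.

Lemma seq_num_surj (A : Type) (nuA : nat -> A) :
  (forall a, exists c, nuA c = a) -> forall s, exists c, seq_num nuA c = s.
Proof.
move=> sA s; suff [t <-] : exists t, map nuA t = s.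
  by exists (CodeSeq.code t); rewrite /seq_num CodeSeq.codeK.
elim: s => [|a s [t <-]]; first by exists [::].
by have [c <-] := sA a; exists (c :: t).
Qed.

Lemma rat_num_surj (q : rat) : exists c, rat_num c = q.
Proof.
have [d Ed] : exists d, denq q = d.+1%:Z.
  by have := denq_gt0 q; case: (denq q) => [[|d]|d] // _; exists d.
have [a [b Eab]] : exists a b : nat, numq q = a%:Z - b%:Z.
  case: (numq q) => k; first by exists k, 0%N; rewrite subr0.
  by exists 0%N, k.+1; rewrite NegzE sub0r.
exists (CodeSeq.code [:: a; b; d]); rewrite /rat_num CodeSeq.codeK /=.
by rewrite -[RHS]divq_num_den Eab Ed rmorphB.
Qed.

Definition computable_real (R : realType) (x : R) : Prop :=
  exists f : nat -> rat, computable_wrt nat_num rat_num f /\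
    forall k, `|ratr (f k) - x| < 2 ^- k.

Variant scalar_kind := RealScalars | ComplexScalars.

Definition scalar_field (R : realType) (F : scalar_kind) : numFieldType :=
  match F with
  | RealScalars => R : numFieldType
  | ComplexScalars => R[i]%C : numFieldType
  end.

(* The modulus with values in R (the library's `|z| of a complex z is itself a
   complex number). *)
Definition modulus (R : realType) (F : scalar_kind) : scalar_field R F -> R :=
  match F return scalar_field R F -> R with
  | RealScalars => fun x : R => `|x|
  | ComplexScalars => fun z : R[i]%C => complex.Re `|z|
  end.

(* F_Q is Q in the real case; in the complex case it is Q(i), where (a, b)
   stands for a + ib. *)
Definition rational_scalar (F : scalar_kind) : Type :=
  match F with
  | RealScalars => rat
  | ComplexScalars => (rat * rat)%type
  end.

Definition rational_scalar_num (F : scalar_kind) : nat -> rational_scalar F :=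
  match F return nat -> rational_scalar F with
  | RealScalars => rat_num
  | ComplexScalars => pair_num rat_num rat_num
  end.

Definition scalar_of_rational (R : realType) (F : scalar_kind) :
    rational_scalar F -> scalar_field R F :=
  match F return rational_scalar F -> scalar_field R F with
  | RealScalars => fun q : rat => ratr q : R
  | ComplexScalars => fun z : rat * rat => (ratr z.1 +i* ratr z.2)%C : R[i]%C
  end.

Lemma rational_scalar_num_surj (F : scalar_kind) (a : rational_scalar F) :
  exists c, rational_scalar_num F c = a.
Proof.
case: F a => /= a; first exact: rat_num_surj.
exact: (pair_num_surj rat_num_surj rat_num_surj).
Qed.

Section Presentations.
Variables (R : realType) (F : scalar_kind).
Variables (V : lmodType (scalar_field R F)) (nrm : V -> R).
Implicit Type v : nat -> V.

Definition lin_comb v (a : seq (scalar_field R F)) : V :=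
  \sum_(j < size a) a`_j *: v j.

Definition rational_vector v (a : seq (rational_scalar F)) : V :=
  lin_comb v (map (@scalar_of_rational R F) a).

Definition is_presentation v : Prop :=
  forall (x : V) (e : R), 0 < e ->
    exists a : seq (scalar_field R F), nrm (x - lin_comb v a) < e.

Definition is_computable_presentation v : Prop :=
  is_presentation v /\
  exists f : nat * seq (rational_scalar F) -> rat,
    computable_wrt (pair_num nat_num (seq_num (rational_scalar_num F)))
      rat_num f /\
    forall (k : nat) (a : seq (rational_scalar F)),
      `|ratr (f (k, a)) - nrm (rational_vector v a)| < 2 ^- k.

Definition computably_presentable : Prop :=
  exists v : nat -> V, is_computable_presentation v.

End Presentations.

Definition lp_norm (R : realType) (F : scalar_kind) (n : nat) (p : R)
    (x : 'rV[scalar_field R F]_n) : R :=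
  (\sum_(j < n) modulus (x 0 j) `^ p) `^ p^-1.

(* Main.v *)
Require Import Defs.
From mathcomp Require Import all_boot all_order all_algebra.
From mathcomp Require Import zify ring lra.
From mathcomp Require Import complex classical_sets interval_inference.
From mathcomp Require Import reals exp hoelder.

(* The James constant J = sup min(|x + y|, |x - y|) over the unit ball of l^p_n
   equals 2^(1/p) for p <= 2 and 2^(1 - 1/p) for p >= 2: the upper bound sums a
   coordinatewise Clarkson inequality, and it is attained at (e1, e2), resp. at
   multiples of (e1 + e2, e1 - e2).  Finitely many v_i span the space, so every
   vector is, after scaling by T, within a bounded distance of the lattice of
   (Gaussian) integer combinations of these v_i.  Hence evaluating norms of
   lattice vectors in a box of size O(T), up to error 2 only, yields a recursive
   A : nat -> nat with A(T) = T J + O(1).  The integer part of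
   N log2(A(2^N)) is then N^2 + N log2 J + O(1), so some recursive H satisfies
   H(N) = N/p + O(1), and N/H(N) with N = c 2^k is within 2^-k of p. *)

Set Implicit Arguments.
Unset Strict Implicit.
Unset Printing Implicit Defensive.

Import Order.TTheory GRing.Theory Num.Theory.

(** * Recursive functions *)

Local Open Scope nat_scope.

Lemma recursive_ext n (f g : n.-tuple nat -> nat) :
  f =1 g -> recursive f -> recursive g.
Proof.
move=> fg rf; apply: (recursive_comp (g := fun i v => tnth v i) rf) => [i|v].
  exact: recursive_proj.
by rewrite -fg; congr f; apply: eq_from_tnth => i; rewrite tnth_mktuple.
Qed.

Lemma recursive_tnth n (i : 'I_n) : recursive (fun v : n.-tuple nat => tnth v i).
Proof. exact: recursive_proj. Qed.

Lemma recursive_app1 n (f : 1.-tuple nat -> nat) (g : n.-tuple nat -> nat) :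
  recursive f -> recursive g -> recursive (fun v => f [tuple g v]).
Proof.
move=> rf rg; apply: (recursive_comp (g := fun=> g) rf) => // v; congr f.
by apply: eq_from_tnth => i; rewrite ord1 tnth_mktuple.
Qed.

Lemma recursive_S n (f : n.-tuple nat -> nat) :
  recursive f -> recursive (fun v => (f v).+1).
Proof.
move=> rf; apply: recursive_ext (recursive_app1 (f := fun v => (tnth v ord0).+1) _ rf).
  by [].
exact: recursive_succ.
Qed.

Lemma recursive_const n c : recursive (fun _ : n.-tuple nat => c).
Proof. by elim: c => [|c IH]; [exact: recursive_zero | exact: recursive_S]. Qed.

Lemma recursive_behead n (f : n.-tuple nat -> nat) :
  recursive f -> recursive (fun v : n.+1.-tuple nat => f [tuple of behead v]).
Proof.
move=> rf; apply: (recursive_comp (g := fun i (v : n.+1.-tuple nat) =>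
  tnth v (inord i.+1)) rf) => [i|v]; first exact: recursive_proj.
by congr f; apply: eq_from_tnth => i; rewrite tnth_mktuple tnth_behead.
Qed.

Lemma recursive_app n (f : n.+1.-tuple nat -> nat) (b : n.-tuple nat -> nat) :
  recursive f -> recursive b -> recursive (fun v => f [tuple of b v :: v]).
Proof.
move=> rf rb; apply: (recursive_comp (g := fun i v => tnth [tuple of b v :: v] i) rf).
  move=> i; case: (unliftP ord0 i) => [j|] ->.
    by apply: recursive_ext (recursive_tnth j) => v; rewrite tnthS.
  by apply: recursive_ext rb => v; rewrite tnth0.
by move=> v; congr f; apply: eq_from_tnth => i; rewrite tnth_mktuple.
Qed.

Lemma behead_tupleE n (y : nat) (v : n.-tuple nat) :
  [tuple of behead [tuple of y :: v]] = v.
Proof. exact: val_inj. Qed.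

(** Curried primitive recursion: [s] takes the counter, the previous value and the parameters.
    Substituting [b] for the recursion variable lets closure under an arithmetic operation follow in
    one application. *)
Lemma recursive_rect n (f : n.-tuple nat -> nat)
    (h : nat -> n.-tuple nat -> nat) (b : n.-tuple nat -> nat)
    (s : nat -> nat -> n.-tuple nat -> nat) :
  recursive f ->
  recursive (fun v : n.+2.-tuple nat => s (thead v)
    (thead [tuple of behead v]) [tuple of behead [tuple of behead v]]) ->
  (forall v, h 0 v = f v) ->
  (forall y v, h y.+1 v = s y (h y v) v) ->
  recursive b -> recursive (fun v => h (b v) v).
Proof.
move=> rf rs h0 hS rb.
pose k (v : n.+1.-tuple nat) := h (thead v) [tuple of behead v].
have kE y (v : n.-tuple nat) : k [tuple of y :: v] = h y v.
  by rewrite /k theadE behead_tupleE.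
have rk : recursive k.
  apply: recursive_primrec rf rs _ _ => [v|y v]; rewrite !kE // hS !theadE.
  by congr (s y _ _); apply: val_inj.
by apply: recursive_ext (recursive_app rk rb) => v; rewrite kE.
Qed.

(** The zeros of [f] in [y] form an upward closed set with least element [h v], which yields both
    conditions of minimization at once. *)
Lemma recursive_min n (f : nat -> n.-tuple nat -> nat) (h : n.-tuple nat -> nat) :
  recursive (fun v : n.+1.-tuple nat => f (thead v) [tuple of behead v]) ->
  (forall v y, (f y v == 0) = (h v <= y)) -> recursive h.
Proof.
move=> rf fP; apply: recursive_mu rf _ _ => [v|v y yh].
  by apply/eqP; rewrite theadE behead_tupleE fP.
by rewrite theadE behead_tupleE fP -ltnNge.
Qed.

(** * Arithmetic, bounded maxima and integer logarithms *)

Lemma recursive_thead n : recursive (fun v : n.+1.-tuple nat => thead v).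
Proof. exact: recursive_proj. Qed.

Lemma recursive_thead_behead n :
  recursive (fun v : n.+2.-tuple nat => thead [tuple of behead v]).
Proof. exact: recursive_behead (recursive_thead n). Qed.

Lemma recursive_add n (f g : n.-tuple nat -> nat) :
  recursive f -> recursive g -> recursive (fun v => f v + g v).
Proof.
move=> rf rg.
apply: (recursive_rect (h := fun y v => y + g v) (s := fun _ z _ => z.+1)) rf => //.
  exact: rg.
exact/recursive_S/recursive_thead_behead.
Qed.

Lemma recursive_pred n (f : n.-tuple nat -> nat) : recursive f -> recursive (fun v => (f v).-1).
Proof.
move=> rf.
apply: (recursive_rect (f := fun=> 0) (h := fun y v => y.-1)
  (s := fun y _ _ => y)) rf => //; first exact: recursive_const.
exact: recursive_thead.
Qed.

Lemma recursive_sub n (f g : n.-tuple nat -> nat) :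
  recursive f -> recursive g -> recursive (fun v => f v - g v).
Proof.
move=> rf rg.
apply: (recursive_rect (h := fun y v => f v - y) (s := fun _ z _ => z.-1)) rg => [||v|y v].
- exact: rf.
- exact/recursive_pred/recursive_thead_behead.
- by rewrite subn0.
- by rewrite subnS.
Qed.

Lemma recursive_mul n (f g : n.-tuple nat -> nat) :
  recursive f -> recursive g -> recursive (fun v => f v * g v).
Proof.
move=> rf rg.
apply: (recursive_rect (f := fun=> 0) (h := fun y v => y * g v)
  (s := fun _ z v => g v + z)) rf => //.
  exact: recursive_const.
apply: recursive_add (recursive_thead_behead _).
exact: recursive_behead (recursive_behead rg).
Qed.

Lemma recursive_exp n (f g : n.-tuple nat -> nat) :
  recursive f -> recursive g -> recursive (fun v => f v ^ g v).
Proof.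
move=> rf rg.
apply: (recursive_rect (f := fun=> 1) (h := fun y v => f v ^ y)
  (s := fun _ z v => f v * z)) rg => // [||y v].
- exact: recursive_const.
- apply: recursive_mul (recursive_thead_behead _).
  exact: recursive_behead (recursive_behead rf).
- by rewrite expnS.
Qed.

Lemma recursive_max n (f g : n.-tuple nat -> nat) :
  recursive f -> recursive g -> recursive (fun v => maxn (f v) (g v)).
Proof.
move=> rf rg; have := recursive_add rf (recursive_sub rg rf).
by apply: recursive_ext => v; rewrite maxnE.
Qed.

Lemma recursive_minn n (f g : n.-tuple nat -> nat) :
  recursive f -> recursive g -> recursive (fun v => minn (f v) (g v)).
Proof.
move=> rf rg; have := recursive_sub rf (recursive_sub rf rg).
by apply: recursive_ext => v; rewrite minnE.
Qed.

Lemma recursive_leq n (f g : n.-tuple nat -> nat) :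
  recursive f -> recursive g -> recursive (fun v => (f v <= g v)%N : nat).
Proof.
move=> rf rg; have := recursive_sub (recursive_const _ 1) (recursive_sub rf rg).
by apply: recursive_ext => v; rewrite -subn_eq0; case: (f v - g v).
Qed.

Lemma recursive_bigmax n (F : nat -> n.-tuple nat -> nat) (b : n.-tuple nat -> nat) :
  recursive (fun v : n.+1.-tuple nat => F (thead v) [tuple of behead v]) ->
  recursive b -> recursive (fun v => \max_(j < b v) F j v).
Proof.
move=> rF.
apply: (recursive_rect (f := fun=> 0) (h := fun y v => \max_(j < y) F j v)
  (s := fun y z v => maxn z (F y v))) => [||v|y v].
- exact: recursive_const.
- apply: recursive_max (recursive_thead_behead _) _.
  (* The step function receives the counter, the previous maximum and the parameters; [F] needs this
     tuple without its second entry. *)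
  have rl := recursive_comp (m := n.+1) (n := n.+2) (g := fun i v =>
    if unlift ord0 i is Some j then tnth [tuple of behead [tuple of behead v]] j
    else thead v) rF.
  apply: rl => [i|v]; last first.
    congr (F _ _); first by rewrite [RHS]tnth_mktuple unlift_none.
    apply: eq_from_tnth => i; rewrite !tnth_behead tnth_mktuple.
    have Ei : inord i.+1 = lift ord0 i by apply: val_inj; rewrite /= inordK ?ltnS.
    by rewrite Ei liftK !tnth_behead Ei.
  case: unliftP => [j _|_]; last exact: recursive_thead.
  exact: recursive_behead (recursive_behead (recursive_tnth j)).
- by rewrite big_ord0.
- by rewrite big_ord_recr.
Qed.

(** The quotient is the least y with f < (y + 1)(g + 1); the successor keeps the divisor
    positive. *)
Lemma recursive_divS n (f g : n.-tuple nat -> nat) :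
  recursive f -> recursive g -> recursive (fun v => f v %/ (g v).+1).
Proof.
move=> rf rg.
apply: (recursive_min (f := fun y v => (f v).+1 - y.+1 * (g v).+1)).
  apply: recursive_sub; first exact/recursive_S/(recursive_behead rf).
  apply: recursive_mul; first exact/recursive_S/recursive_thead.
  exact/recursive_S/(recursive_behead rg).
by move=> v y; rewrite subn_eq0 -ltnS -[RHS]ltnS ltn_divLR.
Qed.

Lemma recursive_log2 n (f : n.-tuple nat -> nat) :
  recursive f -> recursive (fun v => trunc_log 2 (f v)).
Proof.
move=> rf; apply: (recursive_min (f := fun y v => (f v).+1 - 2 ^ y.+1)).
  apply: recursive_sub; first exact/recursive_S/(recursive_behead rf).
  apply: recursive_exp; first exact: recursive_const.
  exact/recursive_S/recursive_thead.
move=> v y; rewrite subn_eq0; case: (posnP (f v)) => [->|fv0].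
  by rewrite trunc_log0 leq0n expn_gt0.
apply/idP/idP => [lt_f|le_y].
  by rewrite -ltnS -(@ltn_exp2l 2) //; apply: leq_ltn_trans lt_f; exact: trunc_logP.
by apply: leq_trans (@trunc_log_ltn 2 (f v) isT) _; rewrite leq_exp2l.
Qed.

(** For positive [f v] this is the least y such that 2^(y + 1) does not divide [f v]. The factor
    [f v] stops the search at 0 when [f v] is 0, where the valuation is 0 by convention. *)
Lemma recursive_logn2 n (f : n.-tuple nat -> nat) : recursive f -> recursive (fun v => logn 2 (f v)).
Proof.
move=> rf; apply: (recursive_min (f := fun y v => f v * (1 - f v %% 2 ^ y.+1))).
  have rf' := recursive_behead rf.
  have re : recursive (fun v : n.+1.-tuple nat => 2 ^ (thead v).+1).
    apply: recursive_exp; first exact: recursive_const.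
    exact/recursive_S/recursive_thead.
  apply: recursive_mul => //; apply: recursive_sub; first exact: recursive_const.
  have rq := recursive_divS rf' (recursive_pred re).
  have := recursive_sub rf' (recursive_mul rq re).
  apply: recursive_ext => v; rewrite prednK ?expn_gt0 //.
  by rewrite {1}(divn_eq (f [tuple of behead v]) (2 ^ (thead v).+1)) addKn.
move=> v y; rewrite muln_eq0 subn_eq0; case: (posnP (f v)) => [->|fv0] /=.
  by rewrite logn0.
have -> : (0 < f v %% 2 ^ y.+1) = ~~ (2 ^ y.+1 %| f v) by rewrite lt0n.
by rewrite pfactor_dvdn // -leqNgt.
Qed.

(* code (a :: s) = 2 ^ a * (code s).*2.+1, so a is a 2-adic valuation. *)
Definition code_tail (c : nat) : nat := c %/ 2 ^ (logn 2 c).+1.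

Definition code_nth (c i : nat) : nat := logn 2 (iter i code_tail c).

Lemma code_tail_cons a s : code_tail (CodeSeq.code (a :: s)) = CodeSeq.code s.
Proof.
rewrite /code_tail /= lognM ?expn_gt0 // pfactorK // logn_coprime ?addn0; last first.
  by rewrite coprime2n /= odd_double.
by rewrite expnSr divnMl ?expn_gt0 // divn2 /= uphalf_double.
Qed.

(** Beyond the end of the list both sides are 0: [code_tail] fixes 0, the code of the empty list,
    and [logn 2 0 = 0] agrees with the default of [nth]. *)
Lemma code_nthE c i : code_nth c i = nth 0 (CodeSeq.decode c) i.
Proof.
rewrite -{1}[c]CodeSeq.decodeK; elim: (CodeSeq.decode c) i => [|a s IH] i.
  rewrite nth_nil /code_nth; have -> : iter i code_tail (CodeSeq.code [::]) = 0.
    by elim: i => //= i ->; rewrite /code_tail div0n.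
  by rewrite logn0.
case: i => [|i]; last by rewrite /code_nth iterSr code_tail_cons; exact: IH.
by rewrite /code_nth /= lognM ?expn_gt0 // pfactorK // logn_coprime ?addn0 // coprime2n /= odd_double.
Qed.

Lemma recursive_code_nth n (f : n.-tuple nat -> nat) i :
  recursive f -> recursive (fun v => code_nth (f v) i).
Proof.
move=> rf; apply: recursive_logn2; elim: i => //= i IH.
have re : recursive (fun v => 2 ^ (logn 2 (iter i code_tail (f v))).+1).
  apply: recursive_exp; first exact: recursive_const.
  exact/recursive_S/recursive_logn2.
have := recursive_divS IH (recursive_pred re).
by apply: recursive_ext => v; rewrite prednK ?expn_gt0.
Qed.

Lemma recursive_code n (h : nat -> n.-tuple nat -> nat) (s : seq nat) :
  (forall i, recursive (h i)) ->
  recursive (fun v => CodeSeq.code [seq h i v | i <- s]).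
Proof.
move=> rh; elim: s => [|i s IH] /=; first exact: recursive_const.
apply: recursive_mul.
  by apply: recursive_exp => //; exact: recursive_const.
apply: recursive_S; have := recursive_add IH IH.
by apply: recursive_ext => v; rewrite addnn.
Qed.

(** Prepending an entry at most [B] multiplies the bound by 2^(B + 1). All lists of a given length
    with entries in a box thus have codes below an explicit number, so a bounded maximum can range
    over them. *)
Lemma code_bound B s : all (leq^~ B) s -> CodeSeq.code s < 2 ^ (B.+1 * size s).
Proof.
elim: s => [|a s IH] /=; first by rewrite muln0.
case/andP=> aB /IH {}IH; rewrite [B.+1 * _]mulnS expnD expnS -mulnA.
have h1 : 2 ^ a <= 2 ^ B by rewrite leq_exp2l.
have h2 : 0 < 2 ^ a by rewrite expn_gt0.
move: IH; set c := CodeSeq.code s; set e := 2 ^ (_ * _) => IH.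
have : 2 ^ a * c.*2.+1 < 2 * (2 ^ a * c.+1) by nia.
move/leq_trans; apply; rewrite leq_mul2l /=; exact: leq_mul.
Qed.

Local Open Scope ring_scope.

(** * Clarkson inequalities *)

Section PowerInequalities.
Variable R : realType.
Implicit Types a b r p : R.

(** Split (a + b)^r as a (a + b)^(r - 1) + b (a + b)^(r - 1) and use that t^(r - 1) is monotone. *)
Lemma powR_superadd a b r :
  1 <= r -> 0 <= a -> 0 <= b -> a `^ r + b `^ r <= (a + b) `^ r.
Proof.
move=> r1 a0 b0; have r0 : 0 < r by apply: lt_le_trans r1.
rewrite -(mulr_powRB1 a0 r0) -(mulr_powRB1 b0 r0) -(mulr_powRB1 (addr_ge0 a0 b0) r0).
rewrite mulrDl lerD // ler_wpM2l //;
  by apply: ge0_ler_powR; rewrite ?nnegrE ?subr_ge0 ?addr_ge0 ?lerDl ?lerDr.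
Qed.

Lemma powR_convex2 a b r w : 1 <= r -> 0 <= a -> 0 <= b -> 0 <= w <= 1 ->
  (w * a + (1 - w) * b) `^ r <= w * a `^ r + (1 - w) * b `^ r.
Proof.
move=> r1 a0 b0 /andP[w0 w1].
by apply: (convex_powR r1 (Itv01 w0 w1)); rewrite inE /= in_itv /= andbT.
Qed.

Lemma powR_midconvex a b r : 1 <= r -> 0 <= a -> 0 <= b ->
  (a + b) `^ r <= 2 `^ (r - 1) * (a `^ r + b `^ r).
Proof.
move=> r1 a0 b0; have r0 : 0 < r by apply: lt_le_trans r1.
have w01 : 0 <= (2^-1 : R) <= 1 by apply/andP; split; lra.
have := powR_convex2 r1 a0 b0 w01.
have -> : 1 - 2^-1 = 2^-1 :> R by lra.
rewrite -!mulrDr powRM ?addr_ge0 ?invr_ge0 // => h.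
rewrite powRB ?powRr1 ?pnatr_eq0 ?implybT //.
have h2 : 0 < (2 : R) `^ r by rewrite powR_gt0.
have := ler_wpM2l (ltW h2) h.
by rewrite mulrA -powRM ?invr_ge0 // mulfV ?pnatr_eq0 // powR1 mul1r mulrA.
Qed.

Lemma powRK a r : 0 <= a -> r != 0 -> (a `^ r) `^ r^-1 = a.
Proof. by move=> a0 r0; rewrite -powRrM mulfV // powRr1. Qed.

(** Superadditivity for the exponent 1/r, applied to a^r and b^r. *)
Lemma powR_subadd a b r :
  0 < r -> r <= 1 -> 0 <= a -> 0 <= b -> (a + b) `^ r <= a `^ r + b `^ r.
Proof.
move=> r0 r1 a0 b0; have rn0 : r != 0 by rewrite gt_eqF.
have := @powR_superadd (a `^ r) (b `^ r) r^-1.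
rewrite invf_ge1 // r1 !powRK // => /(_ isT (powR_ge0 _ _) (powR_ge0 _ _)) h.
have := ge0_ler_powR (ltW r0) _ _ h.
rewrite !nnegrE addr_ge0 // powR_ge0 => /(_ isT isT) /le_trans; apply.
by rewrite -powRrM mulVf // powRr1 ?addr_ge0 ?powR_ge0.
Qed.

(** Midpoint convexity for the exponent 1/r, applied to a^r and b^r, then raised to the power r. *)
Lemma powR_midconcave a b r : 0 < r -> r <= 1 -> 0 <= a -> 0 <= b ->
  a `^ r + b `^ r <= 2 `^ (1 - r) * (a + b) `^ r.
Proof.
move=> r0 r1 a0 b0; have rn0 : r != 0 by rewrite gt_eqF.
have := @powR_midconvex (a `^ r) (b `^ r) r^-1.
rewrite invf_ge1 // r1 !powRK // => /(_ isT (powR_ge0 _ _) (powR_ge0 _ _)) h.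
have := ge0_ler_powR (ltW r0) _ _ h.
rewrite !nnegrE mulr_ge0 ?addr_ge0 ?powR_ge0 // => /(_ isT isT).
rewrite -powRrM mulVf // powRr1 ?addr_ge0 ?powR_ge0 // => /le_trans; apply.
by rewrite powRM ?addr_ge0 ?powR_ge0 // -powRrM mulrBl mulVf // mul1r.
Qed.

(** This is max(2, 2^(p - 1)), the optimal c in |x + y|^p + |x - y|^p <= c (|x|^p + |y|^p). *)
Definition clarkson_const p : R := if p <= 2 then 2 else 2 `^ (p - 1).

(* The hypothesis is the parallelogram identity, with u = |x + y| and
   w = |x - y| in the application. *)
Lemma clarkson_pointwise p a b u w : 1 <= p ->
  0 <= a -> 0 <= b -> 0 <= u -> 0 <= w ->
  u ^+ 2 + w ^+ 2 = 2 * (a ^+ 2 + b ^+ 2) ->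
  u `^ p + w `^ p <= clarkson_const p * (a `^ p + b `^ p).
Proof.
move=> p1 a0 b0 u0 w0 uw; set r := p / 2.
have r0 : 0 < r by rewrite /r; lra.
(* Writing p-th powers as r-th powers of squares, with r = p/2, brings in the parallelogram
   identity. For p <= 2 apply concavity and then subadditivity of t^r; for p > 2 apply
   superadditivity and then convexity. *)
have sqE x : 0 <= x -> x `^ p = (x ^+ 2) `^ r.
  by move=> x0; rewrite -powR_mulrn // -powRrM; congr (_ `^ _); rewrite /r; lra.
have a2 := sqr_ge0 a; have b2 := sqr_ge0 b.
rewrite !sqE // /clarkson_const; case: ifPn => p2.
  have r1 : r <= 1 by rewrite /r; lra.
  apply: le_trans (powR_midconcave r0 r1 (sqr_ge0 _) (sqr_ge0 _)) _.
  rewrite uw powRM ?addr_ge0 // mulrA -powRD ?pnatr_eq0 ?implybT // subrK powRr1 //.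
  by rewrite ler_wpM2l // powR_subadd.
have r1 : 1 <= r by move: p2; rewrite -ltNge /r; lra.
apply: le_trans (powR_superadd r1 (sqr_ge0 _) (sqr_ge0 _)) _.
rewrite uw powRM ?addr_ge0 //.
have -> : p - 1 = r + (r - 1) by rewrite /r; lra.
rewrite powRD ?pnatr_eq0 ?implybT // -mulrA ler_wpM2l ?powR_ge0 //.
exact: powR_midconvex.
Qed.

End PowerInequalities.

(** * The modulus on real and complex scalars *)

Section Modulus.
Variables (R : realType) (F : scalar_kind).
Implicit Types x y z : scalar_field R F.

Lemma modulus_ge0 z : 0 <= modulus z.
Proof.
by case: F z => [z|[a b]] //=; rewrite sqrtr_ge0.
Qed.

Lemma modulusM x y : modulus (x * y) = modulus x * modulus y.
Proof.
by case: F x y => /= x y; [exact: normrM | exact: ComplexField.Normc.normcM].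
Qed.

Lemma modulusD x y : modulus (x + y) <= modulus x + modulus y.
Proof.
by case: F x y => /= x y; [exact: ler_normD | exact: le_normcD].
Qed.

Lemma modulus0 : modulus (0 : scalar_field R F) = 0.
Proof. by case: F => /=; [exact: normr0 | exact: ComplexField.Normc.normc0]. Qed.

Lemma modulus_eq0 z : modulus z = 0 -> z = 0.
Proof.
by case: F z => /= z; [exact: normr0_eq0 | exact: ComplexField.Normc.eq0_normc].
Qed.

Lemma modulusN z : modulus (- z) = modulus z.
Proof. by case: F z => /= z; [exact: normrN | exact: normcN]. Qed.

Lemma modulus_sum (I : Type) (s : seq I) (f : I -> scalar_field R F) :
  modulus (\sum_(i <- s) f i) <= \sum_(i <- s) modulus (f i).
Proof.
elim/big_rec2: _ => [|i a b _ h]; first by rewrite modulus0.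
exact: le_trans (modulusD _ _) (lerD _ h).
Qed.

Lemma modulus_nat k : modulus (k%:R : scalar_field R F) = k%:R.
Proof.
case: F; first exact: normr_nat.
have -> : modulus (k%:R : scalar_field R ComplexScalars) = complex.Re `|k%:R : R[i]%C| by [].
by rewrite normr_nat -(rmorph_nat (real_complex R)).
Qed.

Lemma exists_modulus t : 0 <= t -> exists c : scalar_field R F, modulus c = t.
Proof.
case: F => t0 /=; first by exists t; rewrite ger0_norm.
by exists (t%:C)%C; rewrite /= expr0n addr0 sqrtr_sqr ger0_norm.
Qed.

Lemma parallelogram x y :
  modulus (x + y) ^+ 2 + modulus (x - y) ^+ 2 =
  2 * (modulus x ^+ 2 + modulus y ^+ 2).
Proof.
case: F x y => /= [x y|[a b] [c d]] /=.
  by rewrite -!normrX !ger0_norm ?sqr_ge0 //; ring.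
by rewrite !sqr_sqrtr ?addr_ge0 ?sqr_ge0 //; ring.
Qed.

End Modulus.

(** * The l^p norm and its James constant *)

(** The smaller of two numbers is at most their mean. *)
Lemma le_mul_avg (R : realType) (c a b u v s z : R) : 0 <= c -> z <= u -> z <= v ->
  u + v <= c * (a + b) -> a <= s -> b <= s -> z <= c * s.
Proof.
move=> c0 zu zv uv sa sb; have := ler_wpM2l c0 (lerD sa sb); lra.
Qed.

Section LpNorm.
Variables (R : realType) (F : scalar_kind) (n : nat) (p : R).
Hypothesis p1 : 1 <= p.
Implicit Types x y : 'rV[scalar_field R F]_n.
Local Notation "`[ x ]" := (lp_norm p x) (at level 0, format "`[ x ]").

Let p0 : 0 < p. Proof. exact: lt_le_trans p1. Qed.
Let pn0 : p != 0. Proof. by rewrite gt_eqF. Qed.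

Let sum_ge0 x : 0 <= \sum_(j < n) modulus (x 0 j) `^ p.
Proof. by apply: sumr_ge0 => j _; exact: powR_ge0. Qed.

Lemma lp_norm_ge0 x : 0 <= `[x]. Proof. exact: powR_ge0. Qed.

Lemma lp_norm_powR x : `[x] `^ p = \sum_(j < n) modulus (x 0 j) `^ p.
Proof. by rewrite /lp_norm -powRrM mulVf // powRr1. Qed.

Lemma modulus_le_lp_norm x j : modulus (x 0 j) <= `[x].
Proof.
rewrite -[leLHS](powRK (modulus_ge0 _) pn0).
apply: ge0_ler_powR; rewrite ?nnegrE ?powR_ge0 ?invr_ge0 ?(ltW p0) //.
rewrite (bigD1 j) //= lerDl; apply: sumr_ge0 => i _; exact: powR_ge0.
Qed.

Lemma lp_normZ c x : `[c *: x] = modulus c * `[x].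
Proof.
rewrite /lp_norm; under eq_bigr do rewrite mxE modulusM powRM ?modulus_ge0 //.
by rewrite -mulr_sumr powRM ?powR_ge0 // powRK ?modulus_ge0.
Qed.

Lemma lp_norm_eq0 x : `[x] = 0 -> x = 0.
Proof.
move=> x0; apply/rowP => j; rewrite mxE; apply: modulus_eq0.
by apply/eqP; rewrite eq_le modulus_ge0 -{1}x0 modulus_le_lp_norm.
Qed.

(** Minkowski by convexity of t^p: with A and B the norms of x and y, the vector (x + y)/(A + B) is
    the convex combination of x/A and y/B with weight w = A/(A + B). The coordinatewise bounds then
    add up to (A + B)^p. *)
Lemma lp_normD x y : `[x + y] <= `[x] + `[y].
Proof.
have [/lp_norm_eq0 -> | x0] := eqVneq `[x] 0.
  by rewrite add0r lerDr lp_norm_ge0.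
have [/lp_norm_eq0 -> | y0] := eqVneq `[y] 0.
  by rewrite addr0 lerDl lp_norm_ge0.
have {x0}xgt0 : 0 < `[x] by rewrite lt_neqAle eq_sym x0 lp_norm_ge0.
have {y0}ygt0 : 0 < `[y] by rewrite lt_neqAle eq_sym y0 lp_norm_ge0.
move EA: `[x] xgt0 => A xgt0; move EB: `[y] ygt0 => B ygt0.
have AB0 := addr_gt0 xgt0 ygt0.
have [w wE] : exists w, w = A / (A + B) by eexists.
have w01 : 0 <= w <= 1.
  by rewrite wE divr_ge0 ?(ltW xgt0) ?(ltW AB0) //= ler_pdivrMr // mul1r lerDl ltW.
rewrite -[leRHS](powRK (ltW AB0) pn0).
apply: ge0_ler_powR; rewrite ?nnegrE ?powR_ge0 ?invr_ge0 ?(ltW p0) //.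
suff h j : modulus ((x + y) 0 j) `^ p <=
  (A + B) `^ p * (w * (A `^ p)^-1 * modulus (x 0 j) `^ p +
                  (1 - w) * (B `^ p)^-1 * modulus (y 0 j) `^ p).
  apply: le_trans (ler_sum _ (fun j _ => h j)) _.
  rewrite -mulr_sumr big_split /= -!mulr_sumr -!lp_norm_powR EA EB.
  rewrite !mulfVK ?gt_eqF ?powR_gt0 //.
  by rewrite addrC subrK mulr1.
have invp t : 0 < t -> (t `^ p)^-1 = t^-1 `^ p.
  move=> t0; apply: (@mulIf _ (t `^ p)); first by rewrite gt_eqF ?powR_gt0.
  by rewrite mulVf ?gt_eqF ?powR_gt0 // -powRM ?invr_ge0 ?(ltW t0) // mulVf ?gt_eqF // powR1.
have a0 := modulus_ge0 (x 0 j); have b0 := modulus_ge0 (y 0 j).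
have A0 : 0 <= A^-1 by rewrite invr_ge0 ltW.
have B0 : 0 <= B^-1 by rewrite invr_ge0 ltW.
rewrite !invp // -!mulrA -!powRM //.
have := powR_convex2 p1 (mulr_ge0 A0 a0) (mulr_ge0 B0 b0) w01.
move/(ler_wpM2l (powR_ge0 (A + B) p)) => h; apply: le_trans h.
rewrite -powRM ?(ltW AB0) //; last first.
  by case/andP: w01 => w0 w1; rewrite addr_ge0 // !mulr_ge0 // subr_ge0.
apply: ge0_ler_powR; rewrite ?nnegrE ?modulus_ge0 ?(ltW p0) //.
  case/andP: w01 => w0 w1; rewrite mulr_ge0 ?(ltW AB0) //.
  by rewrite addr_ge0 // !mulr_ge0 // subr_ge0.
rewrite mxE; apply: le_trans (modulusD _ _) _.
rewrite le_eqVlt; apply/orP; left; apply/eqP; rewrite wE.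
by field; rewrite !gt_eqF.
Qed.

Definition james_const : R := clarkson_const p `^ p^-1.

(** The p-th power of the minimum is at most the mean of the p-th powers of the two norms, which the
    summed Clarkson inequality bounds; then take p-th roots. *)
Lemma lp_norm_james x y t : `[x] <= t -> `[y] <= t ->
  Num.min `[x + y] `[x - y] <= james_const * t.
Proof.
move=> xt yt; have t0 : 0 <= t := le_trans (lp_norm_ge0 x) xt.
have c0 : 0 <= clarkson_const p.
  by rewrite /clarkson_const; case: ifP => // _; exact: powR_ge0.
have [m [m0 [mD mB ->]]] : exists m, 0 <= m /\
    [/\ m <= `[x + y], m <= `[x - y] & Num.min `[x + y] `[x - y] = m].
  exists (Num.min `[x + y] `[x - y]).
  split; first by rewrite le_min; apply/andP; split; exact: lp_norm_ge0.
  split=> //; rewrite ge_min; apply/orP; [left | right]; exact: lexx.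
have mono u v : 0 <= u -> u <= v -> u `^ p <= v `^ p.
  move=> u0 uv; apply: ge0_ler_powR; rewrite ?nnegrE ?(ltW p0) //.
  exact: le_trans uv.
have mp : m `^ p <= clarkson_const p * t `^ p.
  have h1 : m `^ p <= `[x + y] `^ p by apply: mono.
  have h2 : m `^ p <= `[x - y] `^ p by apply: mono.
  have h3 : `[x + y] `^ p + `[x - y] `^ p <= clarkson_const p * (`[x] `^ p + `[y] `^ p).
    have sum2 (u v : 'rV[scalar_field R F]_n) : `[u] `^ p + `[v] `^ p =
        \sum_(j < n) (modulus (u 0 j) `^ p + modulus (v 0 j) `^ p).
      by rewrite big_split /=; congr (_ + _); exact: lp_norm_powR.
    have h j : modulus ((x + y) 0 j) `^ p + modulus ((x - y) 0 j) `^ p <=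
        clarkson_const p * (modulus (x 0 j) `^ p + modulus (y 0 j) `^ p).
      rewrite !mxE; apply: clarkson_pointwise; rewrite ?modulus_ge0 //.
      exact: parallelogram.
    have := ler_sum (index_enum 'I_n) (fun j (_ : xpredT j) => h j).
    rewrite -mulr_sumr => hs.
    apply: (eq_ind_r (fun z => z <= _)) (sum2 (x + y) (x - y)).
    apply: (eq_ind_r (fun z => _ <= clarkson_const p * z)) (sum2 x y).
    exact: hs.
  have h4 := mono _ _ (lp_norm_ge0 x) xt; have h5 := mono _ _ (lp_norm_ge0 y) yt.
  exact: (le_mul_avg c0 h1 h2 h3 h4 h5).
rewrite -[m](powRK m0 pn0) -[t](powRK t0 pn0) -powRM ?powR_ge0 //.
by apply: ge0_ler_powR; rewrite ?nnegrE ?mulr_ge0 ?powR_ge0 ?invr_ge0 ?(ltW p0).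
Qed.

Lemma lp_norm_pair (i j : 'I_n) (a b : scalar_field R F) : i != j ->
  `[a *: delta_mx 0 i + b *: delta_mx 0 j] =
  (modulus a `^ p + modulus b `^ p) `^ p^-1.
Proof.
move=> ij; rewrite /lp_norm; congr (_ `^ _).
rewrite (bigD1 i) //= (bigD1 j) 1?eq_sym //= big1 ?addr0 => [|k /andP[/negPf ki /negPf kj]].
  rewrite !mxE !eqxx /= (negPf ij) eq_sym (negPf ij).
  by rewrite !mulr0 !mulr1 addr0 add0r.
by rewrite !mxE ki kj /= !mulr0 addr0 modulus0 powR0.
Qed.

Lemma exists_james_pair : (1 < n)%N -> exists x y,
  [/\ `[x] <= 1, `[y] <= 1, james_const <= `[x + y] & james_const <= `[x - y]].
Proof.
move=> n1; have n0 : (0 < n)%N by apply: ltnW.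
have ij : Ordinal n0 != Ordinal n1 by [].
move: (Ordinal n0) (Ordinal n1) ij => i j ij.
pose d a b : 'rV[scalar_field R F]_n := a *: delta_mx 0 i + b *: delta_mx 0 j.
pose N (a b : scalar_field R F) := (modulus a `^ p + modulus b `^ p) `^ p^-1.
have dN a b : `[d a b] = N a b by exact: lp_norm_pair.
have dD a b a' b' : d a b + d a' b' = d (a + a') (b + b').
  by rewrite /d addrACA -!scalerDl.
have dB a b a' b' : d a b - d a' b' = d (a - a') (b - b').
  by rewrite /d opprD -!scaleNr addrACA -!scalerDl.
have key a b a' b' : N a b <= 1 -> N a' b' <= 1 ->
    james_const <= N (a + a') (b + b') -> james_const <= N (a - a') (b - b') ->
    exists x y,
    [/\ `[x] <= 1, `[y] <= 1, james_const <= `[x + y] & james_const <= `[x - y]].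
  move=> h1 h2 h3 h4; exists (d a b), (d a' b').
  have ND := etrans (congr1 (lp_norm p) (dD a b a' b')) (dN _ _).
  have NB := etrans (congr1 (lp_norm p) (dB a b a' b')) (dN _ _).
  split.
  - exact: (eq_ind_r (fun z => z <= 1) h1 (dN a b)).
  - exact: (eq_ind_r (fun z => z <= 1) h2 (dN a' b')).
  - exact: (eq_ind_r (fun z => james_const <= z) h3 ND).
  - exact: (eq_ind_r (fun z => james_const <= z) h4 NB).
have m1 : modulus (1 : scalar_field R F) = 1 := modulus_nat R F 1.
have z0 : modulus (0 : scalar_field R F) `^ p = 0 by rewrite modulus0 powR0.
have o1 : modulus (1 : scalar_field R F) `^ p = 1 by rewrite m1 powR1.
rewrite /james_const /clarkson_const in key *; case: ifPn key => p2 key.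
  (* For p <= 2, both e_i + e_j and e_i - e_j have norm 2^(1/p). *)
  apply: (key 1 0 0 1); rewrite /N ?addr0 ?add0r ?subr0 ?sub0r ?modulusN;
    by rewrite ?z0 ?o1 ?addr0 ?add0r ?powR1.
(* For p > 2, modulus 2^(-1/p) makes c (e_i + e_j) and c (e_i - e_j) unit vectors, whose sum 2c e_i
   and difference 2c e_j have norm 2^(1 - 1/p). *)
have [c ct] := exists_modulus F (powR_ge0 (2 : R) (- p^-1)).
have cp : modulus c `^ p = 2^-1.
  by rewrite ct -powRrM mulNr mulVf // powR_inv1.
have ccp : modulus (c + c) `^ p = 2 `^ (p - 1).
  have -> : c + c = 2%:R * c by rewrite mulr_natl.
  rewrite modulusM modulus_nat powRM ?modulus_ge0 // cp.
  by rewrite powRB ?powRr1 // pnatr_eq0 implybT.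
have half2 : 2^-1 + 2^-1 = 1 :> R by lra.
apply: (key c c c (- c)); rewrite /N ?opprK ?subrr ?modulusN ?cp ?half2 ?powR1 //.
  by rewrite ccp z0 addr0.
by rewrite ccp z0 add0r.
Qed.

End LpNorm.

(** * Integer scalars and rounding *)

(** Integers are differences of naturals, so that sums and differences of scalars become entrywise
    sums of naturals. *)
Definition int_scalar (F : scalar_kind) (q : nat -> nat) : rational_scalar F :=
  match F return rational_scalar F with
  | RealScalars => (q 0)%:R - (q 1)%:R : rat
  | ComplexScalars => ((q 0)%:R - (q 1)%:R, (q 2)%:R - (q 3)%:R) : rat * rat
  end.

(** The final 0 stands for the denominator 1, since [rat_num] divides by the successor of the third
    entry. *)
Definition int_scalar_code (F : scalar_kind) (q : nat -> nat) : nat :=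
  match F with
  | RealScalars => CodeSeq.code [:: q 0; q 1; 0%N]
  | ComplexScalars => CodeSeq.code
      [:: CodeSeq.code [:: q 0; q 1; 0%N]; CodeSeq.code [:: q 2; q 3; 0%N]]
  end.

Lemma rational_scalar_num_int F q :
  rational_scalar_num F (int_scalar_code F q) = int_scalar F q.
Proof.
have h a b : rat_num (CodeSeq.code [:: a; b; 0%N]) = a%:R - b%:R.
  by rewrite /rat_num CodeSeq.codeK divr1.
case: F; first exact: h.
rewrite /int_scalar_code [LHS]/pair_num CodeSeq.codeK.
by congr (_, _); exact: h.
Qed.

Lemma recursive_int_scalar_code F n (q : n.-tuple nat -> nat -> nat) :
  (forall l, recursive (fun v => q v l)) ->
  recursive (fun v => int_scalar_code F (q v)).
Proof.
move=> rq.
have r2 (a b : n.-tuple nat -> nat) : recursive a -> recursive b ->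
    recursive (fun v => CodeSeq.code [:: a v; b v; 0%N]).
  move=> ra rb; pose h i := nth (fun=> 0%N) [:: a; b; fun=> 0%N] i.
  have rh i : recursive (h i).
    by case: i => [|[|[|[|i]]]] //; exact: recursive_const.
  exact: (recursive_code (iota 0 3) rh).
case: F => /=; first exact: r2.
pose h i (v : n.-tuple nat) := if i is 0 then CodeSeq.code [:: q v 0%N; q v 1%N; 0%N]
  else CodeSeq.code [:: q v 2%N; q v 3%N; 0%N].
have rh i : recursive (h i) by case: i => [|i]; exact: r2.
exact: (recursive_code (iota 0 2) rh).
Qed.

(* [q] codes (q 0 - q 1) + i (q 2 - q 3), so this permutation negates it. *)
Definition flip_sign (l : nat) : nat :=
  match l with 0 => 1 | 1 => 0 | 2 => 3 | _ => 2 end%N.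

Section LatticeScalars.
Variables (R : realType) (F : scalar_kind).
Local Notation K := (scalar_field R F).

Definition lattice_scalar (q : nat -> nat) : K := scalar_of_rational R (int_scalar F q).

Lemma lattice_scalar_ext q q' :
  (forall l, (l < 4)%N -> q l = q' l) -> lattice_scalar q = lattice_scalar q'.
Proof.
by move=> qq'; rewrite /lattice_scalar; case: F; rewrite /= !qq'.
Qed.

Lemma lattice_scalarD q q' :
  lattice_scalar (fun l => q l + q' l)%N = lattice_scalar q + lattice_scalar q'.
Proof.
rewrite /lattice_scalar; case: F => /=.
  by rewrite !natrD !rmorphB !rmorphD /=; ring.
apply/eqP; rewrite eq_complex /=; apply/andP.
by rewrite !natrD !rmorphB !rmorphD /=; split; apply/eqP; ring.
Qed.

Lemma lattice_scalarB q q' :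
  lattice_scalar (fun l => q l + q' (flip_sign l))%N =
  lattice_scalar q - lattice_scalar q'.
Proof.
rewrite /lattice_scalar; case: F => /=.
  by rewrite !natrD !rmorphB !rmorphD /=; ring.
apply/eqP; rewrite eq_complex /=; apply/andP.
by rewrite !natrD !rmorphB !rmorphD /=; split; apply/eqP; ring.
Qed.

(** Truncate |x| and put the result in the first or the second slot according to the sign of x. *)
Lemma nat_round (x : R) (B : nat) : `|x| <= B%:R ->
  exists a b : nat, [/\ (a <= B)%N, (b <= B)%N & `|x - (a%:R - b%:R)| <= 1].
Proof.
move=> xB; have tB : (Num.truncn `|x| <= B)%N.
  by rewrite -(ler_nat R) (le_trans _ xB) // truncn_le.
have /andP[t1 t2] := truncn_itv (normr_ge0 x); rewrite -natr1 in t2.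
move: (Num.truncn `|x|) tB t1 t2 => t tB t1 t2.
case: (ger0P x) t1 t2 => x0 t1 t2; [exists t, 0%N | exists 0%N, t]; split=> //;
  by rewrite ler_norml; apply/andP; split; lra.
Qed.

(** Real and imaginary parts are rounded separately, each with error at most 1; the resulting
    complex error, at most sqrt 2, is relaxed to 2. *)
Lemma lattice_scalar_round (z : K) (B : nat) : modulus z <= B%:R ->
  exists q, (forall l, (q l <= B)%N) /\ modulus (z - lattice_scalar q) <= 2.
Proof.
rewrite /lattice_scalar; case: F z => [x|[x y]] /= zB.
  have [a [b [aB bB h]]] := nat_round zB.
  exists (fun l => if l == 0%N then a else b); split=> [l|]; first by case: ifP.
  by rewrite /= rmorphB /= !ratr_nat (le_trans h) // ler1n.
have xB : `|x| <= B%:R.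
  by rewrite (le_trans _ zB) // -sqrtr_sqr ler_wsqrtr // lerDl sqr_ge0.
have yB : `|y| <= B%:R.
  by rewrite (le_trans _ zB) // -sqrtr_sqr ler_wsqrtr // lerDr sqr_ge0.
have [a [b [aB bB h]]] := nat_round xB.
have [a' [b' [a'B b'B h']]] := nat_round yB.
exists (fun l => nth b' [:: a; b; a'] l); split=> [l|].
  by case: l => [|[|[|[|l]]]].
rewrite /= !rmorphB /= !ratr_nat.
move: (x - _) (y - _) h h' => u w hu hw.
have uw : u ^+ 2 + w ^+ 2 <= 2 ^+ 2.
  have hu2 : u ^+ 2 <= 1 by rewrite -real_normK ?num_real // expr_le1.
  have hw2 : w ^+ 2 <= 1 by rewrite -real_normK ?num_real // expr_le1.
  lra.
have := ler_wsqrtr uw; rewrite sqrtr_sqr ger0_norm //.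
Qed.

End LatticeScalars.

(** The natural number is the integer part of max(q, 0) for the coded rational q. Less than 1 is
    lost by flooring and less than 1 by the approximation; replacing a negative q by 0 is harmless
    because x >= 0. *)
Lemma floor_rat_num (R : realType) (c : nat) (x : R) :
  0 <= x -> `|ratr (rat_num c) - x| < 1 ->
  `|((code_nth c 0 - code_nth c 1) %/ (code_nth c 2).+1)%:R - x| <= 2.
Proof.
move=> x0; rewrite /rat_num !code_nthE.
set s := CodeSeq.decode c; move: (nth _ s 0) (nth _ s 1) (nth _ s 2) => a b d.
rewrite rmorphM rmorphB fmorphV /= !ratr_nat => h.
have d0 : 0 < d.+1%:R :> R by rewrite ltr0n.
have [ab|/ltnW ab] := leqP a b.
  have ab' : a%:R - b%:R <= 0 :> R by rewrite subr_le0 ler_nat.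
  have : (a%:R - b%:R) / d.+1%:R <= 0 :> R by rewrite pmulr_lle0 // invr_gt0.
  have -> : (a - b = 0)%N by apply/eqP; rewrite subn_eq0.
  move: h; rewrite div0n; move: (_ / _) => r; rewrite ltr_norml => /andP[h1 h2] r0.
  by rewrite ler_norml; apply/andP; split; lra.
rewrite -natrB // in h.
have /andP[h1 h2] : (((a - b) %/ d.+1)%:R <= (a - b)%:R / d.+1%:R :> R) &&
    ((a - b)%:R / d.+1%:R < ((a - b) %/ d.+1)%:R + 1 :> R).
  rewrite ler_pdivlMr // ltr_pdivrMr // natr1 -!natrM ler_nat ltr_nat.
  by rewrite leq_divM ltn_ceil.
move: (_ / _) h1 h2 h => r h1 h2; rewrite ltr_norml => /andP[h3 h4].
by rewrite ler_norml; apply/andP; split; lra.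
Qed.

(** * Coarse computation of the James constant *)

Lemma map_seq_num (A : Type) (nuA : nat -> A) s :
  seq_num nuA (CodeSeq.code s) = map nuA s.
Proof. by rewrite /seq_num CodeSeq.codeK. Qed.

Section CoarseJames.
Variables (R : realType) (F : scalar_kind) (V : lmodType (scalar_field R F)).
Variable nrm : V -> R.
Hypotheses (nrm_ge0 : forall x, 0 <= nrm x)
  (nrmD : forall x y, nrm (x + y) <= nrm x + nrm y)
  (nrmZ : forall c x, nrm (c *: x) = modulus c * nrm x).

Lemma nrmN x : nrm (- x) = nrm x.
Proof.
by rewrite -scaleN1r nrmZ modulusN (modulus_nat R F 1) mul1r.
Qed.

Lemma nrm_sum (I : Type) (s : seq I) (f : I -> V) :
  nrm (\sum_(i <- s) f i) <= \sum_(i <- s) nrm (f i).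
Proof.
elim/big_rec2: _ => [|i a b _ h]; last exact: le_trans (nrmD _ _) (lerD _ h).
by rewrite -[X in nrm X](scale0r 0) nrmZ modulus0 mul0r.
Qed.

Lemma nrm_close x y e : nrm (x - y) <= e -> nrm x <= nrm y + e.
Proof.
by move=> xy; rewrite -[x in nrm x](subrK y) addrC (le_trans (nrmD _ _)) // lerD2l.
Qed.

Variables (v : nat -> V) (f : nat * seq (rational_scalar F) -> rat).
Hypothesis f_approx : forall (k : nat) (a : seq (rational_scalar F)),
  `|ratr (f (k, a)) - nrm (rational_vector v a)| < 2 ^- k.
Variable g : 1.-tuple nat -> nat.
Hypotheses (rg : recursive g)
  (gf : forall c : nat, rat_num (g [tuple c]) =
     f (pair_num nat_num (seq_num (rational_scalar_num F)) c)).
Variable m : nat.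

Definition lattice_vector (q : nat -> nat -> nat) : V :=
  \sum_(i < m) lattice_scalar R F (q i) *: v i.

(** The leading 0 requests precision 2^0 = 1, which is enough: norms of size about T are needed only
    up to a bounded error. *)
Definition floor_norm (q : nat -> nat -> nat) : nat :=
  let c := g [tuple CodeSeq.code [:: 0%N;
    CodeSeq.code [seq int_scalar_code F (q i) | i <- iota 0 m]]] in
  ((code_nth c 0 - code_nth c 1) %/ (code_nth c 2).+1)%N.

Lemma floor_normP q : `|(floor_norm q)%:R - nrm (lattice_vector q)| <= 2.
Proof.
apply: floor_rat_num => //; rewrite gf /pair_num CodeSeq.codeK.
have -> : seq_num (rational_scalar_num F)
    (CodeSeq.code [seq int_scalar_code F (q i) | i <- iota 0 m]) =
    [seq int_scalar F (q i) | i <- iota 0 m].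
  by rewrite map_seq_num -map_comp; apply: eq_map => i; exact: rational_scalar_num_int.
have := f_approx 0 [seq int_scalar F (q i) | i <- iota 0 m].
rewrite expr0 invr1; suff -> : rational_vector v [seq int_scalar F (q i) | i <- iota 0 m] =
  lattice_vector q by [].
rewrite /rational_vector /lin_comb -map_comp !size_map size_iota.
apply: eq_bigr => i _; congr (_ *: _).
by rewrite (nth_map 0%N) ?size_iota // nth_iota.
Qed.

Lemma recursive_floor_norm n (q : n.-tuple nat -> nat -> nat -> nat) :
  (forall i l, recursive (fun u => q u i l)) ->
  recursive (fun u => floor_norm (q u)).
Proof.
move=> rq.
have rc : recursive (fun u => CodeSeq.code
    [seq int_scalar_code F (q u i) | i <- iota 0 m]).
  apply: (recursive_code (h := fun i u => int_scalar_code F (q u i))) => i.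
  exact: recursive_int_scalar_code.
have rp : recursive (fun u => CodeSeq.code [:: 0%N; CodeSeq.code
    [seq int_scalar_code F (q u i) | i <- iota 0 m]]).
  pose h i u := if i is 0 then 0%N else
    CodeSeq.code [seq int_scalar_code F (q u i) | i <- iota 0 m].
  have rh i : recursive (h i) by case: i => // ; exact: recursive_const.
  exact: (recursive_code (iota 0 2) rh).
have rc' := recursive_app1 rg rp.
apply: recursive_divS; last exact: recursive_code_nth.
by apply: recursive_sub; exact: recursive_code_nth.
Qed.

(* [j] codes a list with eight entries per index [i]: four for the [i]-th
   coefficient of each of the two lattice vectors. *)
Definition pair_fst (j i l : nat) : nat := code_nth j (8 * i + l).
Definition pair_snd (j i l : nat) : nat := code_nth j (8 * i + (4 + l)).
Definition addq (q q' : nat -> nat -> nat) i l : nat := q i l + q' i l.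
Definition subq (q q' : nat -> nat -> nat) i l : nat := q i l + q' i (flip_sign l).

Lemma lattice_vectorD q q' :
  lattice_vector (addq q q') = lattice_vector q + lattice_vector q'.
Proof.
rewrite /lattice_vector -big_split; apply: eq_bigr => i _.
by rewrite lattice_scalarD scalerDl.
Qed.

Lemma lattice_vectorB q q' :
  lattice_vector (subq q q') = lattice_vector q - lattice_vector q'.
Proof.
rewrite /lattice_vector -sumrB; apply: eq_bigr => i _.
by rewrite lattice_scalarB scalerBl.
Qed.

(* M bounds the coefficients of an extremal pair, and L absorbs the rounding
   errors. *)
Variables M L : nat.

(** The two comparisons act as 0/1 factors, so a pair outside the ball of radius about T contributes
    0 to the maximum. *)
Definition james_body (T j : nat) : nat :=
  ((floor_norm (pair_fst j) <= T + L) *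
   ((floor_norm (pair_snd j) <= T + L) *
    minn (floor_norm (addq (pair_fst j) (pair_snd j)))
         (floor_norm (subq (pair_fst j) (pair_snd j)))))%N.

(** The range is that of [code_bound] for lists of 8m entries at most T M. Codes of other lists in
    this range do no harm, since the upper bound below holds for every pair. *)
Definition coarse_james (T : nat) : nat :=
  \max_(j < 2 ^ ((T * M).+1 * (8 * m))) james_body T j.

Lemma recursive_coarse_james n (t : n.-tuple nat -> nat) :
  recursive t -> recursive (fun u => coarse_james (t u)).
Proof.
move=> rt; apply: (recursive_bigmax (F := fun j u => james_body (t u) j)); last first.
  apply: recursive_exp; first exact: recursive_const.
  apply: recursive_mul; last exact: recursive_const.
  by apply/recursive_S/recursive_mul => //; exact: recursive_const.
have rT := recursive_add (recursive_behead rt) (recursive_const n.+1 L).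
have r1 i l : recursive (fun u : n.+1.-tuple nat => pair_fst (thead u) i l).
  exact/recursive_code_nth/recursive_thead.
have r2 i l : recursive (fun u : n.+1.-tuple nat => pair_snd (thead u) i l).
  exact/recursive_code_nth/recursive_thead.
apply: recursive_mul.
  by apply: recursive_leq => //; apply: recursive_floor_norm.
apply: recursive_mul.
  by apply: recursive_leq => //; apply: recursive_floor_norm.
by apply: recursive_minn; apply: recursive_floor_norm => i l; apply: recursive_add.
Qed.

Variable J : R.
Hypotheses (J0 : 0 <= J)
  (nrm_james : forall x y t, nrm x <= t -> nrm y <= t ->
     Num.min (nrm (x + y)) (nrm (x - y)) <= J * t).

(** A pair that passes both tests has norms at most T + L + 2, so the James inequality applies with
    that radius; the last 2 is the error of [floor_norm]. *)
Lemma coarse_james_le T : (coarse_james T)%:R <= T%:R * J + (J * (L%:R + 2) + 2).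
Proof.
have B0 : 0 <= T%:R * J + (J * (L%:R + 2) + 2).
  by rewrite !addr_ge0 ?mulr_ge0 ?addr_ge0.
rewrite -truncn_ge_nat //; apply/bigmax_leqP => j _; rewrite truncn_ge_nat //.
rewrite /james_body; set z := pair_fst j; set w := pair_snd j.
have [hz|_] := leqP (floor_norm z) _; last by rewrite mul0n.
have [hw|_] := leqP (floor_norm w) _; last by rewrite mul0n muln0.
rewrite !mul1n.
have := floor_normP z; have := floor_normP w.
have := floor_normP (addq z w); have := floor_normP (subq z w).
rewrite lattice_vectorD lattice_vectorB.
move: hz hw; rewrite -!(ler_nat R) !natrD natr_min.
set x := lattice_vector z; set y := lattice_vector w.
move=> hz hw; rewrite !ler_norml => /andP[_ hB] /andP[_ hD] /andP[hy _] /andP[hx _].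
have h := @nrm_james x y (T%:R + (L%:R + 2)) _ _.
have {}h : Num.min (nrm (x + y)) (nrm (x - y)) <= J * (T%:R + (L%:R + 2)).
  by apply: h; lra.
apply: le_trans (_ : Num.min (nrm (x + y)) (nrm (x - y)) + 2 <= _); last by lra.
rewrite -lerBlDr le_min; apply/andP; split; rewrite lerBlDr.
  by rewrite ge_min; apply/orP; left; lra.
by rewrite ge_min; apply/orP; right; lra.
Qed.

Variables (al be : nat -> scalar_field R F).
Let x0 := \sum_(i < m) al i *: v i.
Let y0 := \sum_(i < m) be i *: v i.
Hypotheses (x01 : nrm x0 <= 1) (y01 : nrm y0 <= 1)
  (JD : J <= nrm (x0 + y0)) (JB : J <= nrm (x0 - y0)).
Hypotheses (alM : forall i, (i < m)%N -> modulus (al i) <= M%:R)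
  (beM : forall i, (i < m)%N -> modulus (be i) <= M%:R)
  (LP : 2 * \sum_(i < m) nrm (v i) + 2 <= L%:R).

(** Each coefficient is off by at most 2, so rounding moves the vector by at most twice the sum of
    the [nrm (v i)]. The remaining 2 in [L] is reserved for the error of [floor_norm]. *)
Lemma lattice_vector_close T q (ga : nat -> scalar_field R F) :
  (forall i, (i < m)%N -> modulus (T%:R * ga i - lattice_scalar R F (q i)) <= 2) ->
  nrm (T%:R *: (\sum_(i < m) ga i *: v i) - lattice_vector q) + 2 <= L%:R.
Proof.
move=> h; apply: le_trans LP; rewrite lerD2r mulr_sumr scaler_sumr -sumrB.
apply: le_trans (nrm_sum _ _) _; apply: ler_sum => i _.
by rewrite scalerA -scalerBl nrmZ ler_wpM2r // h.
Qed.

Lemma exists_lattice_round (T : nat) (ga : nat -> scalar_field R F) :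
  (forall i, (i < m)%N -> modulus (ga i) <= M%:R) ->
  exists q : nat -> nat -> nat, (forall i l, (q i l <= T * M)%N) /\
    (forall i, (i < m)%N -> modulus (T%:R * ga i - lattice_scalar R F (q i)) <= 2).
Proof.
move=> gaM.
have ex i : exists q : nat -> nat, (forall l, (q l <= T * M)%N) /\
    ((i < m)%N -> modulus (T%:R * ga i - lattice_scalar R F q) <= 2).
  case: (ltnP i m) => im; last by exists (fun=> 0%N).
  have [|q [q1 q2]] := @lattice_scalar_round R F (T%:R * ga i) (T * M).
    by rewrite modulusM modulus_nat natrM ler_wpM2l // gaM.
  by exists q.
have [q qP] := boolp.choice ex.
by exists q; split=> [i l|i im]; have [h1 h2] := qP i; auto.
Qed.

(** Rounding T x0 and T y0 gives an admissible pair whose sum and difference are off by at most 2L -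
    4; [floor_norm] costs another 2, which stays within 2L. *)
Lemma coarse_james_ge T : T%:R * J - 2 * L%:R <= (coarse_james T)%:R.
Proof.
have [qx [qxB qxP]] := exists_lattice_round T alM.
have [qy [qyB qyP]] := exists_lattice_round T beM.
(* Blocks of eight entries: the first four round a coefficient of T x0, the last four the one of T
   y0 with the same index. *)
pose e k := (if k %% 8 < 4 then qx (k %/ 8) (k %% 8) else qy (k %/ 8) (k %% 8 - 4))%N.
pose s := mkseq e (8 * m).
have s_bound : all (leq^~ (T * M)%N) s.
  by apply/allP => _ /mapP[k _ ->]; rewrite /e; case: ifP.
have := code_bound s_bound; rewrite size_mkseq => jB.
pose j := Ordinal jB.
have nth_e i l : (i < m)%N -> (l < 8)%N -> code_nth j (8 * i + l) = e (8 * i + l)%N.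
  move=> im l8; rewrite code_nthE /= CodeSeq.codeK nth_mkseq //; lia.
have e_div i l : (l < 8)%N -> ((8 * i + l) %/ 8 = i)%N by move=> l8; lia.
have e_mod i l : (l < 8)%N -> ((8 * i + l) %% 8 = l)%N by move=> l8; lia.
have Ez i : (i < m)%N -> lattice_scalar R F (pair_fst j i) = lattice_scalar R F (qx i).
  move=> im; apply: lattice_scalar_ext => l l4.
  have l8 : (l < 8)%N by lia.
  by rewrite /pair_fst nth_e // /e e_mod // e_div // l4.
have Ew i : (i < m)%N -> lattice_scalar R F (pair_snd j i) = lattice_scalar R F (qy i).
  move=> im; apply: lattice_scalar_ext => l l4.
  have l8 : (4 + l < 8)%N by lia.
  rewrite /pair_snd nth_e // /e e_mod // e_div //.
  have -> : (4 + l < 4)%N = false by lia.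
  by rewrite addKn.
set z := pair_fst j in Ez; set w := pair_snd j in Ew.
have cz : nrm (T%:R *: x0 - lattice_vector z) + 2 <= L%:R.
  by apply: lattice_vector_close => i im; rewrite Ez // qxP.
have cw : nrm (T%:R *: y0 - lattice_vector w) + 2 <= L%:R.
  by apply: lattice_vector_close => i im; rewrite Ew // qyP.
have nT u : nrm (T%:R *: u) = T%:R * nrm u by rewrite nrmZ modulus_nat.
(* The rounded vector has norm at most T + L - 2, so the error 2 of [floor_norm] keeps it within the
   test T + L. *)
have small q u : nrm u <= 1 -> nrm (T%:R *: u - lattice_vector q) + 2 <= L%:R ->
    (floor_norm q <= T + L)%N.
  move=> u1 cq; rewrite -(ler_nat R) natrD.
  have := floor_normP q; rewrite ler_norml => /andP[_ h].
  have h2 : nrm (lattice_vector q) <= nrm (T%:R *: u) + (L%:R - 2).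
    by apply: nrm_close; rewrite -nrmN opprB; lra.
  have h3 : T%:R * nrm u <= T%:R by rewrite ler_piMr.
  rewrite nT in h2; lra.
have large q u : J <= nrm u -> nrm (T%:R *: u - lattice_vector q) <= 2 * L%:R - 2 ->
    T%:R * J - 2 * L%:R <= (floor_norm q)%:R.
  move=> Ju cq; have := floor_normP q; rewrite ler_norml => /andP[h _].
  have h2 := nrm_close cq; rewrite nT in h2.
  have h3 : T%:R * J <= T%:R * nrm u by rewrite ler_wpM2l.
  have L0 : 0 <= nrm (T%:R *: u - lattice_vector q) := nrm_ge0 _.
  lra.
apply: le_trans (_ : (james_body T j)%:R <= _); last first.
  by rewrite ler_nat; exact: (leq_bigmax j).
rewrite /james_body -/z -/w (small z x0) // (small w y0) // !mul1n natr_min le_min.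
apply/andP; split.
  apply: (large _ (x0 + y0)) => //; rewrite lattice_vectorD scalerDr opprD addrACA.
  by apply: le_trans (nrmD _ _) _; lra.
apply: (large _ (x0 - y0)) => //; rewrite lattice_vectorB scalerBr.
rewrite [- (_ - lattice_vector w)]opprD addrACA -[- _ - - _]opprD.
by apply: le_trans (nrmD _ _) _; rewrite nrmN; lra.
Qed.

End CoarseJames.

(** * From the James constant to the exponent *)

Section Spanning.
Variables (R : realType) (F : scalar_kind) (n : nat) (p : R).
Hypotheses (p1 : 1 <= p) (n0 : (0 < n)%N).
Local Notation K := (scalar_field R F).

(** If u Y = 0 then u = u (1 - Y); at a coordinate of largest modulus this gives |u_i| <= n/(n + 1)
    |u_i|, so u = 0. *)
Lemma near_identity_unitmx (Y : 'M[K]_n) :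
  (forall i j, modulus ((i == j)%:R - Y i j) <= n.+1%:R^-1) -> Y \in unitmx.
Proof.
move=> hY; rewrite -row_free_unit; apply: inj_row_free => u uY0.
have [i _ imax] := @arg_maxP _ _ _ (Ordinal n0) xpredT (fun i => modulus (u 0 i)) isT.
suff ui0 : modulus (u 0 i) = 0.
  apply/rowP => j; rewrite mxE; apply: modulus_eq0.
  have := imax j isT; rewrite ui0 => h.
  by apply/eqP; rewrite eq_le modulus_ge0 andbT.
have uiE : u 0 i = \sum_j u 0 j * ((j == i)%:R - Y j i).
  under eq_bigr do rewrite mulrBr; rewrite sumrB.
  have := congr1 (fun z : 'rV[K]_n => z 0 i) uY0; rewrite !mxE => ->.
  rewrite subr0 (bigD1 i) //= eqxx mulr1 big1 ?addr0 // => j /negPf ->.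
  by rewrite mulr0.
have : modulus (u 0 i) <= modulus (u 0 i) * (n%:R / n.+1%:R).
  rewrite {1}uiE; apply: le_trans (modulus_sum _ _) _.
  apply: (@le_trans _ _ (\sum_(j < n) modulus (u 0 i) * n.+1%:R^-1)).
    apply: ler_sum => j _; rewrite modulusM ler_pM ?modulus_ge0 //.
    exact: (imax j isT).
  by rewrite sumr_const card_ord -[leLHS]mulr_natr -mulrA [_ * n%:R]mulrC.
move: (modulus _) (modulus_ge0 (u 0 i)) => t t0.
rewrite -subr_le0 -[t in t - _]mulr1 -mulrBr.
have -> : 1 - n%:R / n.+1%:R = n.+1%:R^-1 :> R.
  by rewrite -natr1; field; rewrite natr1 pnatr_eq0.
rewrite pmulr_lle0 ?invr_gt0 ?ltr0n // => h.
by apply/eqP; rewrite eq_le h t0.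
Qed.

(** Combinations of the v_i that approximate the n unit vectors within 1/(n + 1) are the rows of an
    invertible matrix, hence span; only finitely many v_i occur in them. *)
Lemma presentation_span (v : nat -> 'rV[K]_n) :
  is_presentation (@lp_norm R F n p) v ->
  exists m, forall x, exists ga : nat -> K, x = \sum_(i < m) ga i *: v i.
Proof.
move=> hv.
have e0 : 0 < n.+1%:R^-1 :> R by rewrite invr_gt0 ltr0n.
have [a aP] := boolp.choice (fun j : 'I_n => hv (delta_mx 0 j) _ e0).
pose Y := \matrix_(j, k) lin_comb v (a j) 0 k.
have Yunit : Y \in unitmx.
  apply: near_identity_unitmx => i j; apply: le_trans (ltW (aP i)).
  apply: le_trans (modulus_le_lp_norm p1 _ j).
  by rewrite !mxE eqxx [j == i]eq_sym.
pose m := \max_(j < n) size (a j); exists m => x.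
exists (fun i => \sum_j (x *m invmx Y) 0 j * (a j)`_i).
rewrite -{1}(mulmxKV Yunit x) mulmx_sum_row.
under [RHS]eq_bigr do rewrite scaler_suml.
rewrite exchange_big; apply: eq_bigr => j _ /=.
have -> : row j Y = lin_comb v (a j) by apply/rowP => k; rewrite !mxE.
under [RHS]eq_bigr do rewrite -scalerA; rewrite -scaler_sumr; congr (_ *: _).
have sm : (size (a j) <= m)%N by apply: (leq_bigmax j).
rewrite /lin_comb (big_ord_widen m (fun i => (a j)`_i *: v i)) // big_mkcond /=.
apply: eq_bigr => i _; case: ltnP => // h.
by rewrite nth_default // scale0r.
Qed.

End Spanning.

(** * Logarithms from coarse values *)

Section CoarseLogarithm.
Variables (R : realType) (A : nat -> nat) (J C : R).
Hypotheses (J1 : 1 <= J) (AP : forall T, `|(A T)%:R - T%:R * J| <= C).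

(** Taking the N-th power before the integer logarithm keeps the rounding error on N log2 A(2^N) at
    most 1, rather than N. *)
Definition coarse_log (N : nat) : nat := trunc_log 2 (A (2 ^ N) ^ N).

(** The relative error of A(2^N) is of order C/2^N and changes its logarithm by as much; multiplying
    by N leaves this bounded because N <= 2^N. *)
Lemma coarse_logP (N : nat) : 2 * C < N%:R ->
  `|(coarse_log N)%:R - (N ^ 2)%N%:R - N%:R * (ln J / ln 2)| <= 1 + 2 * C / ln 2.
Proof.
move=> NC.
have C0 : 0 <= C := le_trans (normr_ge0 _) (AP 0).
have J0 : 0 < J by apply: lt_le_trans J1.
have ln20 : 0 < ln (2 : R) by rewrite ln_gt0 // ltr1n.
have := AP (2 ^ N); rewrite ler_norml; set T := (2 ^ N)%N => /andP[hl hu].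
have TN : N%:R <= T%:R :> R by rewrite ler_nat ltnW // ltn_expl.
have T0 : 0 < T%:R :> R by rewrite ltr0n expn_gt0.
have TJ : T%:R <= T%:R * J by rewrite ler_peMr // ltW.
have TJ0 : 0 < T%:R * J by apply: mulr_gt0.
(* From A(T) >= T J - C >= T - C and T >= N > 2C; in [lower] it gives N C / A(T) <= 2C. *)
have Ahalf : N%:R <= 2 * (A T)%:R :> R by lra.
have N0 : 0 < N%:R :> R by apply: le_lt_trans NC; rewrite mulr_ge0.
have A0 : 0 < (A T)%:R :> R by lra.
have lnT : ln (T%:R * J) = N%:R * ln 2 + ln J.
  by rewrite lnM ?posrE // /T natrX lnXn // mulr_natl.
have ln_add (y : R) : 0 < y -> ln (y + C) <= ln y + C / y.
  move=> y0; have -> : y + C = y * (1 + C / y) by field; rewrite gt_eqF.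
  have Cy : 0 <= C / y by rewrite divr_ge0 // ltW.
  rewrite lnM ?posrE ?lerD2l; first by apply: le_ln1Dx; lra.
    by [].
  by lra.
have upper : N%:R * ln (A T)%:R <= N%:R * (N%:R * ln 2 + ln J) + C.
  have h : ln (A T)%:R <= N%:R * ln 2 + ln J + C / (T%:R * J).
    rewrite -lnT; apply: le_trans (ln_add _ TJ0).
    by rewrite ler_ln ?posrE //; lra.
  apply: le_trans (ler_wpM2l (ltW N0) h) _; rewrite mulrDr lerD2l.
  rewrite mulrCA ler_piMr // ler_pdivrMr // mul1r.
  exact: le_trans TN TJ.
have lower : N%:R * (N%:R * ln 2 + ln J) <= N%:R * ln (A T)%:R + 2 * C.
  have h : N%:R * ln 2 + ln J <= ln (A T)%:R + C / (A T)%:R.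
    rewrite -lnT; apply: le_trans (ln_add _ A0).
    by rewrite ler_ln ?posrE //; lra.
  apply: le_trans (ler_wpM2l (ltW N0) h) _; rewrite mulrDr lerD2l.
  rewrite mulrCA mulrC; apply: ler_wpM2r => //.
  by rewrite ler_pdivrMr.
have An0 : (0 < A T)%N by rewrite -(ltr_nat R).
have Xn0 : (0 < A T ^ N)%N by rewrite expn_gt0 An0.
have lnX : N%:R * ln (A T)%:R = ln (A T ^ N)%N%:R :> R by rewrite natrX lnXn // mulr_natl.
have ln2X k : k%:R * ln 2 = ln (2 ^ k)%N%:R :> R by rewrite natrX lnXn // mulr_natl.
have Ll : (coarse_log N)%:R * ln (2 : R) <= N%:R * ln (A T)%:R.
  by rewrite lnX ln2X ler_ln ?posrE ?ltr0n ?expn_gt0 ?An0 // ler_nat trunc_logP.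
have Lu : N%:R * ln (A T)%:R <= ((coarse_log N)%:R + 1) * ln (2 : R).
  rewrite natr1 lnX ln2X ler_ln ?posrE ?ltr0n ?expn_gt0 ?An0 // ler_nat ltnW //.
  exact: trunc_log_ltn.
rewrite -(ler_pM2r ln20) -[X in _ * X <= _](gtr0_norm ln20) -normrM.
have -> : (1 + 2 * C / ln 2) * ln 2 = ln 2 + 2 * C by field; rewrite gt_eqF.
have -> : ((coarse_log N)%:R - (N ^ 2)%N%:R - N%:R * (ln J / ln 2)) * ln 2 =
   (coarse_log N)%:R * ln 2 - N%:R * (N%:R * ln 2 + ln J).
  by rewrite natrX; field; rewrite gt_eqF.
rewrite mulrDl mul1r in Lu.
by rewrite ler_norml; apply/andP; split; lra.
Qed.

End CoarseLogarithm.

(** Truncated subtraction replaces a negative number by 0, which is closer to r >= 0. *)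
Lemma ler_norm_natsub (R : realType) (a b : nat) (r : R) :
  0 <= r -> `|(a - b)%N%:R - r| <= `|a%:R - b%:R - r|.
Proof.
move=> r0; have [ab|/ltnW ab] := leqP b a; first by rewrite natrB.
have -> : (a - b = 0)%N by apply/eqP; rewrite subn_eq0.
have ab' : a%:R <= b%:R :> R by rewrite ler_nat.
rewrite sub0r normrN (ger0_norm r0) ler_normr; apply/orP; right; lra.
Qed.

(** Since N/H(N) - p = (N/p - H(N)) p/H(N), the error is at most C p/H(N), of order 1/N; taking N =
    c 2^k brings it below 2^-k. *)
Lemma computable_real_coarse (R : realType) (p C : R) (H : nat -> nat) (N0 : nat) :
  0 < p ->
  (forall n (t : n.-tuple nat -> nat), recursive t -> recursive (fun u => H (t u))) ->
  (forall N, (N0 <= N)%N -> `|(H N)%:R - N%:R / p| <= C) ->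
  computable_real p.
Proof.
move=> p0 rH HP.
have C0 : 0 <= C := le_trans (normr_ge0 _) (HP N0 (leqnn _)).
(* This makes c/p > p C + C, hence H(N) >= N/p - C > 2^k p C. No algorithm has to find [c] from p
   and C: as a fixed natural number it is a recursive constant. *)
pose c := (maxn N0 (Num.truncn (p * (p * C + C)))).+1.
have cN0 : (N0 <= c)%N by rewrite /c ltnW // ltnS leq_maxl.
have cp : p * (p * C + C) < c%:R.
  by apply: lt_le_trans (truncnS_gt _) _; rewrite ler_nat ltnS leq_maxr.
(* The predecessor offsets the successor in [rat_num]; it loses nothing because H(N) is positive, by
   [H0]. *)
pose G k := CodeSeq.code [:: c * 2 ^ k; 0; (H (c * 2 ^ k)).-1]%N.
exists (fun k => rat_num (G k)); split.
  exists (fun u => G (tnth u ord0)); split=> //.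
  have rN : recursive (fun u : 1.-tuple nat => c * 2 ^ tnth u ord0)%N.
    apply: recursive_mul; first exact: recursive_const.
    by apply: recursive_exp; [exact: recursive_const | exact: recursive_tnth].
  pose h i (u : 1.-tuple nat) := nth 0%N
    [:: c * 2 ^ tnth u ord0; 0; (H (c * 2 ^ tnth u ord0)).-1]%N i.
  have rh i : recursive (h i).
    case: i => [|[|[|i]]] //; try exact: recursive_const.
    exact/recursive_pred/rH.
  exact: (recursive_code (iota 0 3) rh).
move=> k; set N := (c * 2 ^ k)%N.
have N0N : (N0 <= N)%N by rewrite (leq_trans cN0) // leq_pmulr // expn_gt0.
have k1 : 1 <= 2 ^+ k :> R by rewrite exprn_ege1 // ler1n.
have k0 : 0 < 2 ^+ k :> R by apply: lt_le_trans k1.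
have := HP N N0N; rewrite ler_norml => /andP[hl hu].
have NE : N%:R = c%:R * 2 ^+ k :> R by rewrite natrM natrX.
have big : 2 ^+ k * (p * C) < (H N)%:R.
  have h1 : p * C + C < c%:R / p by rewrite ltr_pdivlMr // mulrC.
  have h2 : 2 ^+ k * (p * C + C) < N%:R / p.
    by rewrite NE mulrAC [_ / _ * _]mulrC ltr_pM2l.
  have h3 : C <= 2 ^+ k * C by rewrite ler_peMl.
  by rewrite mulrDr in h2; lra.
have H0 : 0 < (H N)%:R :> R.
  by apply: le_lt_trans big; rewrite !mulr_ge0 // ltW.
have -> : ratr (rat_num (G k)) = N%:R / (H N)%:R :> R.
  rewrite /rat_num CodeSeq.codeK -/N /= subr0 prednK; last by rewrite -(ltr_nat R).
  by rewrite fmorph_div /= !ratr_nat.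
have -> : N%:R / (H N)%:R - p = (N%:R / p - (H N)%:R) * (p / (H N)%:R).
  by field; rewrite !gt_eqF.
rewrite normrM [X in _ * X]ger0_norm ?divr_ge0 ?(ltW p0) ?(ltW H0) //.
have hC : `|N%:R / p - (H N)%:R| <= C by rewrite distrC; exact: HP.
apply: le_lt_trans (ler_wpM2r _ hC) _; first by rewrite divr_ge0 ?(ltW p0) ?(ltW H0).
rewrite mulrA ltr_pdivrMr // [_^-1 * _]mulrC ltr_pdivlMr //.
by rewrite mulrC [C * p]mulrC.
Qed.

Lemma exists_nat_ge (R : realType) (x : R) : exists k : nat, x <= k%:R.
Proof. by exists (Num.truncn x).+1; rewrite ltW // truncnS_gt. Qed.

Lemma ln_james_const (R : realType) (p : R) : 1 <= p ->
  ln (james_const p) / ln 2 = if p <= 2 then p^-1 else 1 - p^-1.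
Proof.
move=> p1; have ln2 : ln (2 : R) != 0 by rewrite gt_eqF // ln_gt0 // ltr1n.
have p0 : p != 0 by rewrite gt_eqF //; apply: lt_le_trans p1.
rewrite /james_const /clarkson_const; case: ifP => _; rewrite !ln_powR; field => //;
  by rewrite p0.
Qed.

Lemma powR_ge1 (R : realType) (a r : R) : 1 <= a -> 0 <= r -> 1 <= a `^ r.
Proof. by move=> a1 r0; rewrite -[leLHS](powRr0 a) ler_powR. Qed.

Lemma james_const_ge1 (R : realType) (p : R) : 1 <= p -> 1 <= james_const p.
Proof.
move=> p1; have pi0 : 0 <= p^-1 by rewrite invr_ge0 (le_trans _ p1).
rewrite /james_const /clarkson_const; case: ifP => _; first by rewrite powR_ge1 // ler1n.
by rewrite -powRrM powR_ge1 ?ler1n // mulr_ge0 // subr_ge0.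
Qed.

Lemma ler_distl_sum (R : realType) (a b c d : R) :
  0 <= c -> 0 <= d -> b - d <= a -> a <= b + c -> `|a - b| <= c + d.
Proof. by move=> ? ? ? ?; rewrite ler_norml; apply/andP; split; lra. Qed.

Lemma dist_complement (R : realType) (t b l q : R) :
  `|t + b - l - t * q| = `|l - b - t * (1 - q)|.
Proof. by rewrite -normrN; congr (`|_|); ring. Qed.

Theorem theorem8p1 (R : realType) (F : scalar_kind) (n : nat) (p : R)
    (hn : (2 <= n)%N) (hp : 1 <= p) :
  computably_presentable (@lp_norm R F n p) -> computable_real p.
Proof.
case=> v [hv [f [[g [rg gf]] fP]]].
have [m span] := presentation_span hp (ltnW hn) hv.
have [x [y [x1 y1 JD JB]]] := exists_james_pair F hp hn.
have [al xE] := span x; have [be yE] := span y; rewrite {}xE {}yE in x1 y1 JD JB.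
have [M MP] := exists_nat_ge (\sum_(i < m) (modulus (al i) + modulus (be i))).
have le_M (i : 'I_m) : modulus (al i) + modulus (be i) <= M%:R.
  apply: le_trans MP; rewrite (bigD1 i) //= lerDl sumr_ge0 // => j _.
  by rewrite addr_ge0 // modulus_ge0.
have alM i : (i < m)%N -> modulus (al i) <= M%:R.
  by move=> im; apply: le_trans (le_M (Ordinal im)); rewrite lerDl modulus_ge0.
have beM i : (i < m)%N -> modulus (be i) <= M%:R.
  by move=> im; apply: le_trans (le_M (Ordinal im)); rewrite lerDr modulus_ge0.
have [L LP] := exists_nat_ge (2 * \sum_(i < m) lp_norm p (v i) + 2).
have J1 := james_const_ge1 hp; have J0 : 0 <= james_const p := le_trans ler01 J1.
pose A := coarse_james F g m M L.
have A_le := coarse_james_le (@lp_norm_ge0 R F n p) fP gf m M L J0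
  (@lp_norm_james R F n p hp).
have A_ge := coarse_james_ge (@lp_norm_ge0 R F n p) (@lp_normD R F n p hp)
  (@lp_normZ R F n p hp) fP gf J0 x1 y1 JD JB alM beM LP.
pose C := james_const p * (L%:R + 2) + 2 + 2 * L%:R.
have AP T : `|(A T)%:R - T%:R * james_const p| <= C.
  apply: ler_distl_sum (A_ge T) (A_le T) => //.
  by rewrite addr_ge0 // mulr_ge0 // addr_ge0.
(* log2 J is 1/p or 1 - 1/p, hence the two formulas. No algorithm has to decide whether p <= 2: one
   of two recursive functions is chosen once and for all. *)
pose H N := if p <= 2 then (coarse_log A N - N ^ 2)%N else (N + N ^ 2 - coarse_log A N)%N.
have [N0 N0P] := exists_nat_ge (2 * C + 1).
have p0 : 0 < p by apply: lt_le_trans hp.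
apply: (@computable_real_coarse R p (1 + 2 * C / ln 2) H N0) => // [k t rt|N N0N].
  have rN2 := recursive_exp rt (recursive_const k 2).
  have rL : recursive (fun u => coarse_log A (t u)).
    apply: recursive_log2; apply: recursive_exp => //.
    apply: (recursive_coarse_james F rg m M L (t := fun u => 2 ^ t u)%N).
    by apply: recursive_exp => //; exact: recursive_const.
  rewrite /H; case: (p <= 2); first exact: recursive_sub.
  by apply: recursive_sub => //; apply: recursive_add.
have NC : 2 * C < N%:R.
  apply: lt_le_trans (_ : N0%:R <= _); last by rewrite ler_nat.
  by apply: lt_le_trans N0P; rewrite ltrDl.
have := coarse_logP J1 AP NC; rewrite ln_james_const // /H.
have p'0 : 0 <= p^-1 by rewrite invr_ge0 ltW.
case: ifP => _ h; apply: le_trans (ler_norm_natsub _ _ (mulr_ge0 _ p'0)) _ => //.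
by rewrite natrD dist_complement.
Qed.
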